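(* Let $A\in\mathbb{R}^{n\times n}$ be a nonsingular matrix and $\nu=\|A^{-1}\|_2$. Suppose $\nu\in(0,1)$ and, for $\tau\in\left(0,\frac{2}{\nu+1}\right)$, let $$U=U(\tau)=\begin{bmatrix}0 & \nu\\ 0 & \tau\nu+|1-\tau|\end{bmatrix}.$$ Then the optimal iterative parameter, i.e. the (unique) point of the interval $\left(0,\frac{2}{\nu+1}\right)$ at which the spectral radius $\rho(U(\tau))$ attains its minimum over that interval, is $\tau=1$.
   Context: $\|\cdot\|_2$ denotes the matrix norm induced by the Euclidean norm and $\rho(\cdot)$ denotes the spectral radius. Here $\tau$ is the parameter of the fixed point iteration $x^{(k+1)}=A^{-1}(y^{(k)}+b)$, $y^{(k+1)}=(1-\tau)y^{(k)}+\tau|x^{(k+1)}|$ for solving $Ax-|x|=b$, where $|x|$ is the entrywise absolute value, and $U$ is the matrix bounding the errors of the iteration. *)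

(* Defs.v *)
From HB Require Import structures.
From mathcomp Require Import all_boot all_order all_algebra.
From mathcomp Require Import complex.
From mathcomp Require Import classical_sets set_interval reals.

Set Implicit Arguments.
Unset Strict Implicit.
Unset Printing Implicit Defensive.

Import Order.TTheory GRing.Theory Num.Theory.
Local Open Scope classical_set_scope.
Local Open Scope ring_scope.

Definition norm2 (R : realType) (n : nat) (x : 'cV[R]_n) : R :=
  Num.sqrt (\sum_(i < n) x i 0 ^+ 2).

(* The unit ball rather than the unit sphere, so that the supremum is over a
   nonempty set even when n = 0. *)
Definition mxnorm2 (R : realType) (m n : nat) (A : 'M[R]_(m, n)) : R :=
  sup [set norm2 (A *m x) | x in [set x : 'cV[R]_n | norm2 x <= 1]].

(* The eigenvalues of a real matrix are taken in R[i]; normc is the R-valued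
   modulus. [eigenvalue] refers to row eigenvectors, which does not affect the
   spectrum. The set is finite, and nonempty when n > 0, so sup is a maximum. *)
Definition spectral_radius (R : realType) (n : nat) (M : 'M[R]_n) : R :=
  sup [set Normc.normc l
      | l in [set l : R[i] | eigenvalue (map_mx (real_complex R) M) l]].

Definition U_mx (R : realType) (nu tau : R) : 'M[R]_(1 + 1) :=
  block_mx 0 nu%:M
           0 (tau * nu + `|1 - tau|)%:M.

Definition minimizer_on (R : realType) (D : set R) (f : R -> R) (x : R) : Prop :=
  D x /\ forall y, D y -> f x <= f y.

(* Main.v *)
Require Import Defs.
From mathcomp Require Import all_boot all_order all_algebra.
From mathcomp Require Import complex.
From mathcomp Require Import classical_sets set_interval reals.
From mathcomp Require Import lra.

(** The matrix [U(t)] is upper triangular with diagonal [0] and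
    [g(t) = t * nu + |1 - t|], and [g >= 0] for positive [t] and [nu], so its
    spectral radius is [g(t)] ([spectral_radius_U_mx]).  For [0 < nu < 1] the
    function [g] decreases with slope [nu - 1] up to [t = 1] and increases with
    slope [nu + 1] afterwards, so [g(t) > g(1) = nu] for every [t <> 1]
    ([error_factor_gt]); and [1] lies in the interval because [nu < 1]. *)

Import Order.TTheory GRing.Theory Num.Theory.
Local Open Scope classical_set_scope.
Local Open Scope ring_scope.

Lemma normc_real_complex (R : rcfType) (c : R) :
  Normc.normc (real_complex R c) = `|c|.
Proof. by rewrite /= expr0n addr0 sqrtr_sqr. Qed.

(** A left eigenvector [(x, y)] of this matrix satisfies [0 = l x] and
    [x b + y c = l y]; hence [l = 0], or [x = 0] and [l = c]. *)
Lemma eigenvalue_ublock0_inv (F : fieldType) (b c l : F) :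
  eigenvalue (block_mx 0 b%:M 0 c%:M : 'M_(1 + 1)) l -> l = 0 \/ l = c.
Proof.
case/eigenvalueP=> v; rewrite -[v]hsubmxK mul_row_block !mulmx0 add0r.
rewrite !mul_mx_scalar scale_row_mx => /eq_row_mx [x_eq y_eq] v_neq0.
have [->|l_neq0] := eqVneq l 0; [by left | right].
move/esym/eqP: x_eq; rewrite scaler_eq0 (negPf l_neq0) /= => /eqP x0.
move: y_eq v_neq0; rewrite x0 scaler0 add0r => /eqP.
rewrite -subr_eq0 -scalerBl scaler_eq0 => /orP[|/eqP->].
  by rewrite subr_eq0 => /eqP.
by rewrite row_mx0 eqxx.
Qed.

(** The second unit row vector is a left eigenvector. *)
Lemma eigenvalue_ublock0 (F : fieldType) (b c : F) :
  eigenvalue (block_mx 0 b%:M 0 c%:M : 'M_(1 + 1)) c.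
Proof.
apply/eigenvalueP; exists (row_mx 0 1%:M).
  rewrite mul_row_block !mulmx0 !mul0mx !add0r mul1mx.
  by rewrite scale_row_mx scaler0 scalemx1.
apply/eqP; rewrite -[0 in RHS]row_mx0 => /eq_row_mx [_ /matrixP/(_ 0 0)].
by rewrite !mxE eqxx => /eqP; rewrite oner_eq0.
Qed.

Lemma spectral_radius_U_mx (R : realType) (nu t : R) :
  0 <= t * nu + `|1 - t| ->
  spectral_radius (U_mx nu t) = t * nu + `|1 - t|.
Proof.
set c := t * nu + _ => c_ge0.
have U_complex : map_mx (real_complex R) (U_mx nu t) =
    block_mx 0 (real_complex R nu)%:M 0 (real_complex R c)%:M.
  by rewrite /U_mx -/c map_block_mx !map_mx0 !map_scalar_mx.
rewrite /spectral_radius U_complex.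
set S := [set _ | _ in _].
have Sc : S c.
  exists (real_complex R c); first exact: eigenvalue_ublock0.
  by rewrite normc_real_complex ger0_norm.
have ubSc : ubound S c.
  move=> _ [l /eigenvalue_ublock0_inv [-> | ->] <-].
    by rewrite Normc.normc0.
  by rewrite normc_real_complex ger0_norm.
apply/eqP; rewrite eq_le ge_sup //=; last by exists c.
by rewrite ub_le_sup //; exists c.
Qed.

Lemma error_factor_gt (R : realDomainType) (nu t : R) :
  -1 < nu < 1 -> t != 1 -> nu < t * nu + `|1 - t|.
Proof.
move=> /andP[nu_gt nu_lt]; rewrite neq_lt => /orP[t_lt1 | t_gt1].
  have : 0 < (1 - t) * (1 - nu) by rewrite mulr_gt0 // subr_gt0.
  by rewrite ger0_norm; [lra | rewrite subr_ge0 ltW].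
have : 0 < (t - 1) * (nu + 1) by rewrite mulr_gt0 //; lra.
by rewrite distrC ger0_norm; [lra | rewrite subr_ge0 ltW].
Qed.

Theorem theorem4p2 (R : realType) (n : nat) (A : 'M[R]_n) (nu : R)
    (A_unit : A \in unitmx)
    (nuE : nu = mxnorm2 (invmx A))
    (nu01 : 0 < nu < 1) (tau : R) :
  minimizer_on `]0, 2 / (nu + 1)[ (fun t => spectral_radius (U_mx nu t)) tau
  <-> tau = 1.
Proof.
have /andP[nu_gt0 nu_lt1] := nu01.
have rhoE t : 0 < t -> spectral_radius (U_mx nu t) = t * nu + `|1 - t|.
  move=> t_gt0; apply: spectral_radius_U_mx.
  by rewrite addr_ge0 ?normr_ge0 // mulr_ge0 // ltW.
have rho1 : spectral_radius (U_mx nu 1) = nu.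
  by rewrite rhoE ?ltr01 // subrr normr0 addr0 mul1r.
have rho_gt t : 0 < t -> t != 1 -> nu < spectral_radius (U_mx nu t).
  move=> t_gt0 t_neq1; rewrite rhoE //; apply: error_factor_gt => //.
  by rewrite nu_lt1 andbT; lra.
have one_in : `]0, 2 / (nu + 1)[%classic 1.
  by rewrite /= in_itv /= ltr01 ltr_pdivlMr; lra.
split=> [[/= + min_tau]|->].
  rewrite in_itv => /andP[tau_gt0 _]; apply/eqP/contraT => tau_neq1.
  have := min_tau 1 one_in; rewrite rho1 leNgt.
  by rewrite rho_gt.
split=> [|t]; first exact: one_in.
rewrite /= in_itv rho1 => /andP[t_gt0 _].
have [->|t_neq1] := eqVneq t 1; first by rewrite rho1 lexx.
exact/ltW/rho_gt.
Qed.
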